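(* Let $(A,\|\cdot\|)$ be any non-unital, faithful, normed algebra. Then: (1) $\overline{co}\,V_A(a)=V_{A_e^{op}}(a;1)$ for all $a\in A$; (2) $\nu_A(a)=\nu_{A_e^{op}}(a;1)$ for all $a\in A$; (3) $\frac1e\|a+\lambda 1\|_{op}\le \nu_{A_e^{op}}(a+\lambda 1;1)\le\|a+\lambda 1\|_{op}$ for all $a+\lambda 1\in A_e$; (4) $\frac1e\|a\|_{op}\le\nu_A(a)\le\|a\|_{op}$ for all $a\in A$; (5) if $\|\cdot\|$ is regular, then $\frac1e\|a\|\le\nu_A(a)\le\|a\|$ for all $a\in A$; (6) if $\|\cdot\|$ is regular and complete, then $0\in\overline{co}\,V_A(a)$ for all $a\in A$.
   Context: A normed algebra $(A,\|\cdot\|)$ is a complex associative algebra with a submultiplicative norm; it is not assumed to be complete or unital. Non-unital means having no (two-sided) identity element. $A$ is faithful if $a=0$ whenever $a\in A$ and $aA=\{0\}$. $A_e=A+\mathbb{C}1$ is the unitization of $A$, with adjoined identity $1$. The operator norm on $A_e$ is $\|a+\lambda 1\|_{op}=\sup\{\|ax+\lambda x\|:x\in A,\ \|x\|\le 1\}$, and $A_e^{op}=(A_e,\|\cdot\|_{op})$. In general $\|\cdot\|_{op}\le\|\cdot\|$ on $A$; the norm $\|\cdot\|$ is called regular if $\|\cdot\|_{op}=\|\cdot\|$ on $A$. For any normed algebra $B$: $S(B)=\{x\in B:\|x\|=1\}$; $B^*$ is its Banach space dual; $D_B(x)=\{\varphi\in B^*:\|\varphi\|=1=\varphi(x)\}$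 for $x\in S(B)$; $V_B(b;x)=\{\varphi(bx):\varphi\in D_B(x)\}$ for $b\in B$, $x\in S(B)$; the spatial numerical range of $b$ is $V_B(b)=\bigcup\{V_B(b;x):x\in S(B)\}$; the spatial numerical radius is $\nu_B(b)=\sup\{|\lambda|:\lambda\in V_B(b)\}$; and $\nu_B(b;x)=\sup\{|\lambda|:\lambda\in V_B(b;x)\}$. For $K\subset\mathbb{C}$, $\overline{co}(K)$ is the closed convex hull of $K$. Here $e$ in $\frac1e$ is Euler's number. *)

(* Defs.v *)
From HB Require Import structures.
From mathcomp Require Import all_boot all_order all_algebra.
From mathcomp Require Import complex.
From mathcomp Require Import all_classical all_reals all_analysis.

Set Implicit Arguments.
Unset Strict Implicit.
Unset Printing Implicit Defensive.

Import Order.TTheory GRing.Theory Num.Theory.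
Import numFieldNormedType.Exports.

Local Open Scope classical_set_scope.
Local Open Scope ring_scope.
Local Open Scope complex_scope.

(* The ring structures of MathComp all carry an identity element, so a
   possibly non-unital product is added to normed modules. *)
HB.mixin Record NormedModule_isNormedAlgebra (K : numDomainType) A
    of NormedModule K A := {
  amul : A -> A -> A ;
  amulA : associative amul ;
  amulDl : left_distributive amul +%R ;
  amulDr : right_distributive amul +%R ;
  amulZl : forall (k : K) (x y : A), amul (k *: x) y = k *: amul x y ;
  amulZr : forall (k : K) (x y : A), amul x (k *: y) = k *: amul x y ;
  ler_normAM : forall x y : A, `|amul x y| <= `|x| * `|y|
}.

#[short(type="normedAlgType")]
HB.structure Definition NormedAlgebra (K : numDomainType) :=
  {A of NormedModule K A & NormedModule_isNormedAlgebra K A}.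

Reserved Notation "x ** y" (at level 40, left associativity).
Notation "x ** y" := (amul x y) : ring_scope.

(* The norm of a normed module over R[i] takes its values in the nonnegative
   elements of R[i]; rnorm is the same norm with values in R. *)
Definition rnorm (R : rcfType) (V : normedModType R[i]) (x : V) : R :=
  complex.Re `|x|.

Definition non_unital (K : numDomainType) (A : normedAlgType K) : Prop :=
  ~ exists e : A, forall x : A, e ** x = x /\ x ** e = x.

Definition faithful (K : numDomainType) (A : normedAlgType K) : Prop :=
  forall a : A, (forall x : A, a ** x = 0) -> a = 0.

Definition complete_normed (K : numDomainType) (A : normedModType K) : Prop :=
  forall F : set_system A, ProperFilter F -> cauchy F -> cvg F.

(* convex_set is convexity for an R[i]-module with coefficients in {i01 R[i]};
   since 0 <= t in R[i] entails that t is real, these are the usual real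
   convex combinations. *)
Definition closed_convex_hull (R : realType) (K : set R[i]^o) : set R[i]^o :=
  closure (smallest (@convex_set R[i] R[i]^o) K).

Section NumericalRange.
Context (R : realType) (B : normedAlgType R[i]).

Definition unit_sphere : set B := [set x | rnorm x = 1].

Definition dual_norm (f : B -> R[i]^o) : R :=
  sup [set rnorm (f x) | x in [set x : B | rnorm x <= 1]].

Definition support_functionals (x : B) : set {linear B -> R[i]^o} :=
  [set f | [/\ continuous f, dual_norm f = 1 & f x = 1]].

Definition num_range_at (b x : B) : set R[i]^o :=
  [set f (b ** x) | f in support_functionals x].

Definition num_range (b : B) : set R[i]^o :=
  \bigcup_(x in unit_sphere) num_range_at b x.

(* The set of moduli is bounded by rnorm b, as |f (b x)| <= |b| |x|, so that
   sup does not take its default value 0 for lack of an upper bound. *)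
Definition num_radius (b : B) : R :=
  sup [set rnorm l | l in num_range b].

Definition num_radius_at (b x : B) : R :=
  sup [set rnorm l | l in num_range_at b x].

End NumericalRange.

Section RnormTheory.
Context (R : rcfType) (V : normedModType R[i]).
Implicit Types x y : V.

Lemma rnormE x : (rnorm x)%:C = `|x|.
Proof. by rewrite /rnorm RRe_real// ger0_real. Qed.

Lemma rnorm_ge0 x : 0 <= rnorm x.
Proof. by rewrite -lecR rnormE normr_ge0. Qed.

Lemma rnormD x y : rnorm (x + y) <= rnorm x + rnorm y.
Proof. by rewrite -lecR rmorphD/= !rnormE ler_normD. Qed.

Lemma rnormZ (l : R[i]) x : rnorm (l *: x) = rnorm (l : R[i]^o) * rnorm x.
Proof.
by apply: complexI; rewrite rmorphM/= !rnormE normrZ.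
Qed.

Lemma rnorm0 : rnorm (0 : V) = 0.
Proof. by apply: complexI; rewrite rnormE normr0. Qed.

Lemma rnorm_eq0 x : rnorm x = 0 -> x = 0.
Proof. by move=> x0; apply/normr0_eq0; rewrite -rnormE x0. Qed.

End RnormTheory.

Lemma rnormM (R : rcfType) (A : normedAlgType R[i]) (x y : A) :
  rnorm (x ** y) <= rnorm x * rnorm y.
Proof. by rewrite -lecR rmorphM/= !rnormE ler_normAM. Qed.

Section OperatorNorm.
Context (R : realType) (A : normedAlgType R[i]).
(* The pair (a, l) stands for a + l1. *)
Implicit Types (u v : A * R[i]) (x y a : A).

Definition unitization_act u x : A := u.1 ** x + u.2 *: x.

Definition unitization_mul u v : A * R[i] :=
  (u.1 ** v.1 + u.2 *: v.1 + v.2 *: u.1, u.2 * v.2).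

Definition op_norm u : R :=
  sup [set rnorm (unitization_act u x) | x in [set x : A | rnorm x <= 1]].

Local Notation act := unitization_act.

Lemma amulNl x y : (- x) ** y = - (x ** y).
Proof. by rewrite -scaleN1r amulZl scaleN1r. Qed.

Lemma actD u v x : act (u + v) x = act u x + act v x.
Proof. by rewrite /act/= amulDl scalerDl addrACA. Qed.

Lemma actZ (l : R[i]) u x : act (l *: u) x = l *: act u x.
Proof. by rewrite /act/= amulZl scalerDr scalerA. Qed.

Lemma act_scale (l : R[i]) u x : act u (l *: x) = l *: act u x.
Proof. by rewrite /act/= amulZr scalerDr !scalerA mulrC. Qed.

Lemma actM u v x : act (unitization_mul u v) x = act u (act v x).
Proof.
rewrite /act/= !amulDl amulDr !amulZl amulZr amulA scalerDr scalerA -!addrA.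
by congr (_ + _); rewrite addrCA.
Qed.

Let bound u : R := rnorm u.1 + rnorm (u.2 : R[i]^o).

Let act_le u x : rnorm (act u x) <= bound u * rnorm x.
Proof.
apply: (le_trans (rnormD _ _)); rewrite rnormZ mulrDl lerD2r; exact: rnormM.
Qed.

Let bound_ge0 u : 0 <= bound u.
Proof. by rewrite addr_ge0// rnorm_ge0. Qed.

Lemma op_norm_has_sup u : has_sup
  [set rnorm (act u x) | x in [set x : A | rnorm x <= 1]].
Proof.
split.
  by exists (rnorm (act u 0)), 0 => //=; rewrite rnorm0 ler01.
exists (bound u) => _ [x /= x1 <-].
by apply: (le_trans (act_le _ _)); rewrite ler_piMr.
Qed.

Lemma op_norm_ub u x : rnorm x <= 1 -> rnorm (act u x) <= op_norm u.
Proof.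
by move=> x1; apply: ub_le_sup; [have [] := op_norm_has_sup u|exists x].
Qed.

Lemma op_norm_least u (c : R) :
  (forall x, rnorm x <= 1 -> rnorm (act u x) <= c) -> op_norm u <= c.
Proof.
move=> h; apply: ge_sup; first by have [] := op_norm_has_sup u.
by move=> _ [x /= /h ? <-].
Qed.

Lemma op_norm_ge0 u : 0 <= op_norm u.
Proof.
apply: le_trans (op_norm_ub u (x := 0) _); first exact: rnorm_ge0.
by rewrite rnorm0 ler01.
Qed.

Let rnorm_real (r : R) : 0 <= r -> rnorm (r%:C : R[i]^o) = r.
Proof. by move=> r0; rewrite /rnorm ger0_norm// lecR. Qed.

Lemma op_norm_act u x : rnorm (act u x) <= op_norm u * rnorm x.
Proof.
have [/rnorm_eq0 ->|x0] := eqVneq (rnorm x) 0.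
  have -> : act u 0 = 0 by rewrite -[X in act u X](scale0r x) act_scale scale0r.
  by rewrite rnorm0 mulr0.
have xgt0 : 0 < rnorm x by rewrite lt_neqAle eq_sym x0 rnorm_ge0.
have vge0 : 0 <= (rnorm x)^-1 by rewrite invr_ge0 ltW.
have := @op_norm_ub u ((rnorm x)^-1%:C *: x).
rewrite act_scale !rnormZ rnorm_real// mulVf// => /(_ (lexx _)).
by rewrite mulrC ler_pdivrMr.
Qed.

Lemma op_normD u v : op_norm (u + v) <= op_norm u + op_norm v.
Proof.
apply: op_norm_least => x x1; rewrite actD.
by apply: (le_trans (rnormD _ _)); rewrite lerD// op_norm_ub.
Qed.

Let op_normZ_le (l : R[i]) u :
  op_norm (l *: u) <= rnorm (l : R[i]^o) * op_norm u.
Proof.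
apply: op_norm_least => x x1; rewrite actZ rnormZ.
by rewrite ler_wpM2l ?rnorm_ge0// op_norm_ub.
Qed.

Lemma op_normZ (l : R[i]) u :
  op_norm (l *: u) = rnorm (l : R[i]^o) * op_norm u.
Proof.
apply/eqP; rewrite eq_le op_normZ_le/=.
have [->|l0] := eqVneq l 0; first by rewrite rnorm0 mul0r op_norm_ge0.
have lgt0 : 0 < rnorm (l : R[i]^o).
  rewrite lt_neqAle rnorm_ge0 andbT eq_sym.
  by apply: contra_neq l0 => /rnorm_eq0.
have := op_normZ_le l^-1 (l *: u).
rewrite scalerA mulVf// scale1r -ler_pdivlMl//.
have -> : rnorm (l^-1 : R[i]^o) = (rnorm (l : R[i]^o))^-1.
  by apply: complexI; rewrite rnormE normfV -rnormE -rmorphV// unitfE gt_eqF.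
by [].
Qed.

Lemma op_normM u v : op_norm (unitization_mul u v) <= op_norm u * op_norm v.
Proof.
apply: op_norm_least => x x1; rewrite actM.
apply: (le_trans (op_norm_act _ _)).
by rewrite ler_wpM2l ?op_norm_ge0// op_norm_ub.
Qed.

Lemma op_norm_eq0 (nuA : non_unital A) (fA : faithful A) u :
  op_norm u = 0 -> u = 0.
Proof.
move=> u0.
have act0 x : act u x = 0.
  apply: rnorm_eq0; apply/eqP; rewrite eq_le rnorm_ge0 andbT.
  by apply: (le_trans (op_norm_act _ _)); rewrite u0 mul0r.
case: u u0 act0 => a l _ act0.
have [l0|l0] := eqVneq l 0.
  rewrite l0 in act0 *; congr pair; apply: fA => x.
  by have := act0 x; rewrite /act/= scale0r addr0.
exfalso; apply: nuA; exists (- l^-1 *: a).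
have eid x : (- l^-1 *: a) ** x = x.
  have /eqP := act0 x; rewrite /act/= addr_eq0 => /eqP ax.
  by rewrite amulZl ax scalerN scaleNr opprK scalerA mulVf// scale1r.
move=> x; split; first exact: eid.
apply/eqP; rewrite -subr_eq0; apply/eqP/fA => y.
by rewrite amulDl amulNl -amulA eid subrr.
Qed.

End OperatorNorm.

(* The operator norm is a norm on the unitization when the algebra is
   non-unital and faithful; the proofs are kept in the type for that reason. *)
Definition unitization_op (R : realType) (A : normedAlgType R[i])
  (nuA : non_unital A) (fA : faithful A) : Type := (A * R[i])%type.

Section UnitizationOp.
Context (R : realType) (A : normedAlgType R[i]).
Context (nuA : non_unital A) (fA : faithful A).
Local Notation Aop := (unitization_op nuA fA).

HB.instance Definition _ := GRing.Lmodule.copy Aop (A * R[i])%type.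

Let opn (u : Aop) : R[i] := (op_norm u)%:C.

Let opnD (u v : Aop) : opn (u + v) <= opn u + opn v.
Proof. by rewrite /opn -rmorphD/= lecR; exact: op_normD. Qed.

Let opnZ (l : R[i]) (u : Aop) : opn (l *: u) = `|l| * opn u.
Proof. by rewrite /opn op_normZ rmorphM/= rnormE. Qed.

Let opn_eq0 (u : Aop) : opn u = 0 -> u = 0.
Proof. by move=> /complexI; exact: op_norm_eq0. Qed.

HB.instance Definition _ := Lmodule_isNormed.Build R[i] Aop opnD opnZ opn_eq0.

Let mul (u v : Aop) : Aop := unitization_mul u v.

Let mulA : associative mul.
Proof.
move=> [a k] [b l] [c m]; rewrite /mul/unitization_mul/= mulrA; congr pair.
rewrite !amulDl !amulDr !scalerDr !amulZl !amulZr !scalerA amulA.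
rewrite (mulrC m k) (mulrC m l) !addrA.
by rewrite [LHS](AC 7%AC (1*4*2*5*3*6*7)%AC).
Qed.

Let mulDl : left_distributive mul +%R.
Proof.
move=> [a k] [b l] [c m]; rewrite /mul/unitization_mul/= /GRing.add/=.
by rewrite mulrDl amulDl scalerDl scalerDr; congr pair;
  rewrite addrACA (addrACA (a ** c)).
Qed.

Let mulDr : right_distributive mul +%R.
Proof.
move=> [a k] [b l] [c m]; rewrite /mul/unitization_mul/= /GRing.add/=.
by rewrite mulrDr amulDr scalerDl scalerDr; congr pair;
  rewrite addrACA (addrACA (a ** b)).
Qed.

Let mulZl (k : R[i]) (u v : Aop) : mul (k *: u) v = k *: mul u v.
Proof.
case: u v => [a l] [b m]; congr pair; last exact: esym (mulrA k l m).
change ((k *: a) ** b + (k * l) *: b + m *: (k *: a)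
  = k *: (a ** b + l *: b + m *: a)).
by rewrite amulZl !scalerDr !scalerA (mulrC m).
Qed.

Let mulZr (k : R[i]) (u v : Aop) : mul u (k *: v) = k *: mul u v.
Proof.
case: u v => [a l] [b m]; congr pair; last exact: mulrCA.
change (a ** (k *: b) + l *: (k *: b) + (k * m) *: a
  = k *: (a ** b + l *: b + m *: a)).
by rewrite amulZr !scalerDr !scalerA (mulrC l).
Qed.

Let normM (u v : Aop) : `|mul u v| <= `|u| * `|v|.
Proof. by rewrite /Num.norm/= -rmorphM/= lecR; exact: op_normM. Qed.

HB.instance Definition _ := NormedModule_isNormedAlgebra.Build R[i] Aop
  mulA mulDl mulDr mulZl mulZr normM.

Definition unit_op : Aop := (0, 1).

Definition embed_op (a : A) : Aop := (a, 0).

Lemma rnorm_opE (u : Aop) : rnorm u = op_norm u.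
Proof. by []. Qed.

Lemma unit_op_sphere : unit_sphere unit_op.
Proof.
have [x xn0] : exists x : A, x != 0.
  apply: contrapT => A0; apply: nuA; exists 0 => x.
  have Z (y : A) : y = 0 by apply/eqP/negPn/negP => y0; apply: A0; exists y.
  by split; rewrite [LHS]Z [RHS]Z.
have act1 (y : A) : unitization_act (0, 1) y = y.
  by rewrite /unitization_act/= -[0 in LHS](subrr y) amulDl amulNl subrr add0r
    scale1r.
have xgt0 : 0 < rnorm x.
  rewrite lt_neqAle rnorm_ge0 andbT eq_sym.
  by apply: contra_neq xn0 => /rnorm_eq0.
apply/eqP; rewrite eq_le; apply/andP; split.
  by apply: op_norm_least => y y1; rewrite act1.
by have := op_norm_act (0, 1) x; rewrite act1 ler_pMl.
Qed.

Lemma mul_opE (u v : Aop) : u ** v = unitization_mul u v.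
Proof. by []. Qed.

Lemma unitization_opE (a : A) (l : R[i]) :
  embed_op a + l *: unit_op = (a, l).
Proof. by congr pair; rewrite /= ?scaler0 ?addr0// add0r [l *: _]mulr1. Qed.

End UnitizationOp.

Definition regular_norm (R : realType) (A : normedAlgType R[i]) : Prop :=
  forall a : A, op_norm (a, 0) = rnorm a.

(* Main.v *)
Require Import Defs.
From HB Require Import structures.
From mathcomp Require Import all_boot all_order all_algebra.
From mathcomp Require Import cyclic separable cyclotomic complex.
From mathcomp Require Import all_classical all_reals all_analysis.
From mathcomp Require Import zify ring lra.
Import Order.TTheory GRing.Theory Num.Theory.
Import numFieldNormedType.Exports.
Local Open Scope classical_set_scope.
Local Open Scope ring_scope.
Local Open Scope complex_scope.

(* Everything is done with the operators x |-> u x on A, u = a + l1, so that no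
   completion is needed.

   Lumer's argument: if Re phi(u x) <= mu for all unit vectors x and all phi in
   D_A(x), then |(1 - r u) x| >= (1 - r mu) |x| for all x; applied to (1 + r u) x
   this gives |1 + r u|_op <= (1 + r^2 |u^2|_op) / (1 - r mu), and letting r
   tend to 0, Re f(u) <= mu for every state f of A_e^op. Since A_e^op acts on A,
   also phi(a x) = f(a) for some state f. Hence V_A(a) and V_{A_e^op}(a; 1) have
   the same support function, which yields (1) and (2), as the latter set is
   convex and closed: by Hahn-Banach it consists of the z such that
   |k + l z| <= |k1 + l a|_op for all scalars k and l.

   The same estimate, for the rotations of u, bounds the powers (1 + w r u)^n
   with |w| = 1, and Cauchy's estimate for the coefficient of w yields (3).

   For (6), z = 0 satisfies the above criterion unless |1 + b|_op < 1 for some b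
   in A; but then (1 + b)^n tends to 0, and 1 belongs to the closure of A. *)

(** * Hahn-Banach theorem *)

Section Sublinear.
Context (R : realType) (V : lmodType R[i]).
Implicit Types (p q : V -> R) (x y : V).

(** Homogeneity is asked for as an inequality because that is what passes to infima; applying it to
    the inverse scalar turns it into the equality [sublinearZ]. *)
Definition sublinear p :=
  (forall x y, p (x + y) <= p x + p y) /\
  (forall (r : R) x, 0 <= r -> p (r%:C *: x) <= r * p x).

Lemma sublinear0 p : sublinear p -> p 0 = 0.
Proof.
move=> [pD pZ]; apply/eqP; rewrite eq_le; apply/andP; split.
  by have := pZ 0 0 (lexx 0); rewrite scaler0 mul0r.
by have := pD 0 0; rewrite addr0 lerDl.
Qed.

Lemma sublinearN p x : sublinear p -> - p (- x) <= p x.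
Proof.
move=> sp; have [pD _] := sp.
by rewrite -subr_ge0 opprK -(sublinear0 p sp) -(subrr x) pD.
Qed.

Lemma sublinearZ p (r : R) x : sublinear p -> 0 <= r ->
  p (r%:C *: x) = r * p x.
Proof.
move=> sp r0; have [_ pZ] := sp; apply/eqP; rewrite eq_le pZ//=.
have [->|rn0] := eqVneq r 0; first by rewrite scale0r mul0r sublinear0.
have rgt0 : 0 < r by rewrite lt_neqAle eq_sym rn0.
rewrite -ler_pdivlMl//; have := pZ r^-1 (r%:C *: x).
by rewrite scalerA -rmorphM/= mulVf// scale1r invr_ge0; apply.
Qed.

(** A pair (m, r) in the convex cone [G] encodes the constraint q m <= r. The functional q x = inf
    (p (x - m) + r) over [G] satisfies all of them. The last hypothesis is the compatibility of [G]
    with [p]: with subadditivity it bounds the infimum below by - p (- x). *)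
Lemma le_sublinear_cone p (G : set (V * R)) : sublinear p ->
  G (0, 0) ->
  (forall m n r s, G (m, r) -> G (n, s) -> G (m + n, r + s)) ->
  (forall m r (t : R), 0 <= t -> G (m, r) -> G (t%:C *: m, t * r)) ->
  (forall m r, G (m, r) -> - r <= p (- m)) ->
  exists q, [/\ sublinear q, forall x, q x <= p x
              & forall m r, G (m, r) -> q m <= r].
Proof.
move=> sp G0 GD GZ Gp; have [pD pZ] := sp.
pose S x : set R := [set p (x - g.1) + g.2 | g in G].
have Sn0 x : S x !=set0 by exists (p (x - 0) + 0), (0, 0).
have Slb x : lbound (S x) (- p (- x)).
  move=> _ [[m r] /= Gm <-]; have := Gp _ _ Gm; have := pD (x - m) (- x).
  rewrite addrAC subrr add0r; lra.
have Sinf x : has_inf (S x) by split => //; exists (- p (- x)); exact: Slb.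
have qle x m r : G (m, r) -> inf (S x) <= p (x - m) + r.
  by move=> Gm; apply: ge_inf; [exact: (Sinf x).2|exists (m, r)].
exists (fun x => inf (S x)); split.
- split.
    move=> x y; apply/ler_addgt0Pr => e e0.
    have e20 : 0 < e / 2 by rewrite divr_gt0.
    have [_ [[m r] /= Gm <-] h1] := inf_adherent e20 (Sinf x).
    have [_ [[n s] /= Gn <-] h2] := inf_adherent e20 (Sinf y).
    have := qle (x + y) _ _ (GD _ _ _ _ Gm Gn).
    have := pD (x - m) (y - n); rewrite addrACA -opprD.
    by move: h1 h2; set a := inf _; set b := inf _; set c := inf _; lra.
  move=> t x t0; have [t00|tn0] := eqVneq t 0.
    have := qle (t%:C *: x) _ _ G0; rewrite t00 scale0r subr0 mul0r addr0.
    by rewrite (sublinear0 p).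
  have tgt0 : 0 < t by rewrite lt_neqAle eq_sym tn0.
  rewrite mulrC -ler_pdivrMr//; apply: lb_le_inf => // _ [[m r] /= Gm <-].
  rewrite ler_pdivrMr//.
  have := qle (t%:C *: x) _ _ (GZ _ _ _ t0 Gm).
  move=> /le_trans; apply.
  rewrite -scalerBr mulrDl (mulrC r) lerD2r mulrC; exact: pZ.
- move=> x; have := qle x _ _ G0; by rewrite subr0 addr0.
- move=> m r Gm; have := qle m _ _ Gm; by rewrite subrr (sublinear0 p)// add0r.
Qed.

(** Zorn's lemma for the reversed pointwise order: a nonempty chain is bounded by its pointwise
    infimum, which is finite because - p (- x) <= - q (- x) <= q x whenever q is sublinear and below
    [p]. *)
Lemma minimal_sublinear p : sublinear p ->
  exists q, [/\ sublinear q, forall x, q x <= p x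
    & forall q', sublinear q' -> (forall x, q' x <= q x) -> q' = q].
Proof.
move=> sp.
pose T := {q : V -> R | sublinear q /\ forall x, q x <= p x}.
pose ge : rel T := fun c d => `[< forall x, sval d x <= sval c x >].
have [||||[q [sq qp]] qmin] := @Zorn T ge.
- by move=> q; apply/asboolP.
- move=> q1 q2 q3 /asboolP h1 /asboolP h2; apply/asboolP => x.
  exact: le_trans (h2 x) (h1 x).
- move=> [q1 h1] [q2 h2] /asboolP /= le1 /asboolP /= le2.
  by apply: eq_exist; apply/funext => x; apply/eqP; rewrite eq_le le1 le2.
- move=> C Ctot; have [->|/set0P[c0 Cc0]] := eqVneq C set0.
    by exists (exist _ p (conj sp (fun x => lexx (p x)))).
  pose S x : set R := [set sval c x | c in C].
  have Sinf x : has_inf (S x).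
    split; first by exists (sval c0 x), c0.
    exists (- p (- x)) => _ [[c [sc cp]] /= _ <-].
    by apply: le_trans (sublinearN c x sc); rewrite lerN2.
  have qle x c : C c -> inf (S x) <= sval c x.
    by move=> Cc; apply: ge_inf; [exact: (Sinf x).2|exists c].
  suff sq : sublinear (fun x => inf (S x)) /\ forall x, inf (S x) <= p x.
    exists (exist _ (fun x => inf (S x)) sq) => c Cc; apply/asboolP => x /=; exact: qle.
  split; [split|].
  + move=> x y; apply/ler_addgt0Pr => e e0.
    have e20 : 0 < e / 2 by rewrite divr_gt0.
    have [_ [c1 Cc1 <-] h1] := inf_adherent e20 (Sinf x).
    have [_ [c2 Cc2 <-] h2] := inf_adherent e20 (Sinf y).
    (* The smaller of two members of the chain serves at x and at y at once, so subadditivity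
       survives the infimum. *)
    have [c [Cc le1 le2]] : exists c, [/\ C c, sval c x <= sval c1 x &
        sval c y <= sval c2 y].
      have [/asboolP h|/asboolP h] := Ctot _ _ Cc1 Cc2; first by exists c2.
      by exists c1.
    have := qle (x + y) _ Cc; have := (svalP c).1.1 x y.
    by move: h1 h2 le1 le2; set a := inf _; set b := inf _; set d := inf _; lra.
  + move=> t x t0; have [t00|tn0] := eqVneq t 0.
      have := qle (t%:C *: x) _ Cc0; rewrite t00 scale0r mul0r.
      by rewrite (sublinear0 _ (svalP c0).1).
    have tgt0 : 0 < t by rewrite lt_neqAle eq_sym tn0.
    rewrite mulrC -ler_pdivrMr//; apply: lb_le_inf; first exact: (Sinf x).1.
    move=> _ [c Cc <-]; rewrite ler_pdivrMr//.
    apply: (le_trans (qle _ _ Cc)); rewrite mulrC; exact: (svalP c).1.2.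
  + move=> x; apply: le_trans (qle x c0 Cc0) _; exact: (svalP c0).2.
exists q; split=> // q' sq' q'q.
have q'p x : q' x <= p x by apply: le_trans (qp x).
have /qmin : ge (exist _ q (conj sq qp)) (exist _ q' (conj sq' q'p)).
  exact/asboolP.
by move=> /(congr1 sval).
Qed.

(* A minimal sublinear functional is odd: q' built from the half-line through
   y lies below q, so it equals q, while q' (- y) <= - q y. *)
Lemma linear_below p : sublinear p ->
  exists h : V -> R, [/\ forall x y, h (x + y) = h x + h y,
    forall (r : R) x, h (r%:C *: x) = r * h x & forall x, h x <= p x].
Proof.
move=> /minimal_sublinear[q [sq qp qmin]]; have [qD qZ] := sq.
have qN x : q (- x) = - q x.
  pose G : set (V * R) := [set g | exists2 t : R, 0 <= t &
    g = (- (t%:C *: x), - (t * q x))].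
  have [||||q' [sq' q'q q'G]] := le_sublinear_cone q G sq.
  - by exists 0 => //; rewrite scale0r oppr0 mul0r oppr0.
  - move=> m n r s [t t0 [-> ->]] [u u0 [-> ->]]; exists (t + u).
      exact: addr_ge0.
    by rewrite -!opprD -mulrDl -scalerDl -rmorphD.
  - move=> m r t t0 [u u0 [-> ->]]; exists (t * u); first exact: mulr_ge0.
    by rewrite scalerN scalerA -rmorphM mulrN mulrA.
  - by move=> m r [t t0 [-> ->]]; rewrite !opprK sublinearZ.
  - apply/eqP; rewrite eq_le; apply/andP; split; last first.
      by rewrite lerNl; exact: sublinearN.
    rewrite -(qmin _ sq' q'q); apply: q'G; exists 1 => //.
    by rewrite scale1r mul1r (qmin _ sq' q'q).
have qadd x y : q (x + y) = q x + q y.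
  apply/eqP; rewrite eq_le qD/= -lerN2 -qN !opprD -!qN; exact: qD.
have qpos r x : 0 <= r -> q (r%:C *: x) = r * q x by exact: sublinearZ.
exists q; split => // r x; have [/qpos//|r0] := leP 0 r.
have -> : r%:C *: x = - ((- r)%:C *: x) by rewrite rmorphN scaleNr opprK.
by rewrite qN qpos ?oppr_ge0 1?ltW// mulNr opprK.
Qed.

End Sublinear.

(** * The modulus of complex numbers *)

Section Modulus.
Context (R : realType).
Implicit Types (r : R) (z w : R[i]).
Local Notation nm z := (rnorm (z : R[i]^o)).

Lemma rnormC_real r : nm r%:C = `|r|.
Proof. by apply: complexI; rewrite rnormE normc_def/= expr0n addr0 sqrtr_sqr. Qed.

Lemma rnormCM z w : nm (z * w) = nm z * nm w.
Proof. by rewrite -[z * w]/(z *: (w : R[i]^o)) rnormZ. Qed.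

Lemma sqr_rnormC z : nm z ^+ 2 = complex.Re z ^+ 2 + complex.Im z ^+ 2.
Proof. by apply: complexI; rewrite rmorphXn/= rnormE add_Re2_Im2. Qed.

Lemma ReD z w : complex.Re (z + w) = complex.Re z + complex.Re w.
Proof. by case: z w => [a b] [c d]. Qed.

Lemma ReZ r z : complex.Re (r%:C * z) = r * complex.Re z.
Proof. by case: z => a b /=; rewrite mul0r subr0. Qed.

Lemma ReN z : complex.Re (- z) = - complex.Re z.
Proof. by case: z. Qed.

Lemma Re_le_rnorm z : complex.Re z <= nm z.
Proof.
rewrite -lecR rnormE; apply: le_trans (normc_ge_Re z).
by rewrite lecR ler_norm.
Qed.

Lemma rnormCN z : nm (- z) = nm z.
Proof. by apply: complexI; rewrite !rnormE normrN. Qed.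

(** Used to turn bounds on real parts into bounds on moduli. *)
Lemma rotate_rnorm z : exists2 w, nm w = 1 & w * z = (nm z)%:C.
Proof.
have [->|z0] := eqVneq z 0.
  by exists 1; rewrite ?mulr0 ?rnorm0// rnormC_real normr1.
have nz0 : nm z != 0 by apply: contra_neq z0 => /rnorm_eq0.
exists ((nm z)%:C / z); last by rewrite mulfVK.
apply: (mulIf nz0); rewrite -rnormCM mulfVK// mul1r rnormC_real ger0_norm//.
exact: rnorm_ge0.
Qed.

End Modulus.

(** * Complex functionals bounded by the norm *)

Section NormedModule.
Context (R : realType) (V : normedModType R[i]).
Implicit Types (x y u v : V).
Local Notation nm z := (rnorm (z : R[i]^o)).

Lemma rnormN x : rnorm (- x) = rnorm x.
Proof. by apply: complexI; rewrite !rnormE normrN. Qed.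

Lemma rnormZ_real (r : R) x : rnorm (r%:C *: x) = `|r| * rnorm x.
Proof. by rewrite rnormZ rnormC_real. Qed.

Lemma sublinear_rnorm : sublinear R V (@rnorm R V).
Proof.
split=> [x y|r x r0]; first exact: rnormD.
by rewrite rnormZ_real ger0_norm.
Qed.

(** The complex functional with real part [h] is h x - i h (i x). Rotating x makes its value real
    and nonnegative, so the bound on [h] bounds the modulus. *)
Lemma complex_functional (h : V -> R) :
  (forall x y, h (x + y) = h x + h y) ->
  (forall (r : R) x, h (r%:C *: x) = r * h x) ->
  (forall x, h x <= rnorm x) ->
  exists f : {linear V -> R[i]^o},
    (forall x, complex.Re (f x) = h x) /\ (forall x, nm (f x) <= rnorm x).
Proof.
move=> hD hZ hp.
pose f x : R[i]^o := (h x) +i* (- h ('i%C *: x)).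
have hi x : h ('i%C *: ('i%C *: x)) = - h x.
  have -> : 'i%C *: ('i%C *: x) = ((-1)%:C) *: x.
    by rewrite scalerA; congr (_ *: _); simpc.
  by rewrite hZ mulN1r.
have flin : linear f.
  move=> z x y; apply/eqP.
  rewrite /f; case: z => a b; rewrite eq_complex/=.
  have sE w : (a +i* b) *: w = a%:C *: w + b%:C *: ('i%C *: w).
    by rewrite scalerA -scalerDl; congr (_ *: _); simpc.
  have siE w : 'i%C *: ((a +i* b) *: w) = a%:C *: ('i%C *: w) - b%:C *: w.
    rewrite !scalerA -scaleNr -scalerDl; congr (_ *: _).
    by apply/eqP; rewrite eq_complex/=; apply/andP; split; apply/eqP; ring.
  have hN w : h (- w) = - h w.
    by rewrite -scaleN1r -[X in h (X *: _)](rmorphN1 (real_complex R)) hZ mulN1r.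
  by rewrite scalerDr !hD siE sE !hD hN !hZ; apply/andP; split; apply/eqP; ring.
pose fl := GRing.isLinear.Build R[i] V R[i]^o _ f flin.
pose g : {linear V -> R[i]^o} := HB.pack f fl.
exists g; split=> // x; have [w w1 wf] := rotate_rnorm R (g x).
rewrite -[nm _]/(complex.Re (nm (g x))%:C) -wf -[w * g x]/(w *: g x).
rewrite -linearZ/=; apply: le_trans (hp _) _.
by rewrite rnormZ w1 mul1r.
Qed.

(** The hypothesis says that k u + l v |-> k s + l t is well defined and contractive, even when u
    and v are dependent. The constraints of [G] bound the real part on the span from above; since
    the span is stable under negation, they hold with equality. *)
Lemma hahn_banach_two u v (s t : R[i]) :
  (forall k l : R[i], nm (k * s + l * t) <= rnorm (k *: u + l *: v)) ->
  exists f : {linear V -> R[i]^o},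
    [/\ forall x, nm (f x) <= rnorm x, f u = s & f v = t].
Proof.
move=> H.
pose G : set (V * R) := [set g | exists k l : R[i],
  g = (k *: u + l *: v, complex.Re (k * s + l * t))].
have [||||q [sq qp qG]] := le_sublinear_cone R V _ G sublinear_rnorm.
- by exists 0, 0; rewrite !scale0r !mul0r !addr0.
- move=> m n a b [k [l [-> ->]]] [k' [l' [-> ->]]].
  exists (k + k'), (l + l'); congr pair; first by rewrite !scalerDl addrACA.
  by rewrite -ReD !mulrDl addrACA.
- move=> m a r r0 [k [l [-> ->]]]; exists (r%:C * k), (r%:C * l).
  by rewrite scalerDr !scalerA -!mulrA -mulrDr ReZ.
- move=> m a [k [l [-> ->]]]; rewrite rnormN; apply: le_trans (H _ _).
  by have := Re_le_rnorm R (- (k * s + l * t)); rewrite ReN rnormCN.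
have [h [hD hZ hq]] := linear_below R V _ sq.
have [|f [fh fn]] := complex_functional h hD hZ.
  by move=> x; apply: le_trans (qp x).
have Ref k l : complex.Re (k * f u + l * f v) <= complex.Re (k * s + l * t).
  have -> : k * f u + l * f v = f (k *: u + l *: v) by rewrite linearD !linearZ.
  by rewrite fh; apply: le_trans (hq _) (qG _ _ _); exists k, l.
have fE k l : complex.Re (k * f u + l * f v) = complex.Re (k * s + l * t).
  apply/eqP; rewrite eq_le Ref/= -lerN2 -!ReN !opprD -!mulNr; exact: Ref.
have extE (z w : R[i]) : (forall k, complex.Re (k * z) = complex.Re (k * w)) -> z = w.
  case: z w => [a b] [c d] E; have := E 1; have := E 'i%C => /=.
  rewrite !mul0r !mul1r !sub0r !subr0 => /oppr_inj -> ->.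
  by [].
exists f; split=> //; apply: extE => k.
  by have := fE k 0; rewrite !mul0r !addr0.
by have := fE 0 k; rewrite !mul0r !add0r.
Qed.

End NormedModule.

(** * Lumer's estimate *)

Section SupportFunctionals.
Context (R : realType) (B : normedAlgType R[i]).
Local Notation nm z := (rnorm (z : R[i]^o)).

(** A contractive functional with f x = 1 attains its norm at the unit vector x, hence has dual norm
    exactly 1. *)
Lemma support_functionalsP (x : B) (f : {linear B -> R[i]^o}) : rnorm x = 1 ->
  support_functionals x f <-> (forall y, nm (f y) <= rnorm y) /\ f x = 1.
Proof.
move=> x1; split=> [[_ fn fx]|[fn fx]]; split=> //.
  set S := [set rnorm (f y) | y in [set y : B | rnorm y <= 1]] in fn.
  have Sub : has_sup S.
    (* Without a supremum, [sup] would take its default value 0, against the dual norm being 1. *)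
    apply: contrapT => /sup_out S0; have := @ltr01 R.
    by rewrite -[X in 0 < X]fn /dual_norm S0 ltxx.
  move=> y; have [/rnorm_eq0 ->|y0] := eqVneq (rnorm y) 0.
    by rewrite linear0 !rnorm0.
  have ygt0 : 0 < rnorm y by rewrite lt_neqAle eq_sym y0 rnorm_ge0.
  have : nm (f ((rnorm y)^-1%:C *: y)) <= dual_norm f.
    apply: ub_le_sup; first exact: Sub.2.
    exists ((rnorm y)^-1%:C *: y) => //=.
    by rewrite rnormZ_real gtr0_norm ?invr_gt0// mulVf.
  rewrite linearZ/= rnormZ_real gtr0_norm ?invr_gt0// fn.
  by rewrite ler_pdivrMl// mulr1.
- apply: bounded_linear_continuous; apply/bounded_funP => r; exists r => y yr.
  by apply: le_trans yr; rewrite -!rnormE lecR.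
- apply/eqP; rewrite eq_le; apply/andP; split.
    apply: ge_sup; first by exists (nm (f 0)), 0 => //=; rewrite rnorm0.
    by move=> _ [y /= y1 <-]; apply: le_trans (fn y) y1.
  apply: ub_le_sup.
    by exists 1 => _ [y /= y1 <-]; apply: le_trans (fn y) y1.
  by exists x => /=; rewrite ?x1// fx rnormC_real normr1.
Qed.

Lemma support_functionals_neq0 (x : B) : rnorm x = 1 ->
  exists f, support_functionals x f.
Proof.
move=> x1; have [|f [fn fx _]] := hahn_banach_two R B x 0 1 0.
  by move=> k l; rewrite mulr0 scaler0 !addr0 mulr1 rnormZ x1 mulr1.
by exists f; apply/(support_functionalsP _ _ x1).
Qed.

End SupportFunctionals.

Section Lumer.
Context (R : realType) (A : normedAlgType R[i]).
Context (nuA : non_unital A) (fA : faithful A).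
Local Notation Aop := (unitization_op nuA fA).
Local Notation one := (unit_op nuA fA).
Local Notation nm z := (rnorm (z : R[i]^o)).
Local Notation act := unitization_act.
Implicit Types (u : A * R[i]) (mu : R).

Lemma act_one (x : A) : act (0, 1) x = x.
Proof.
by rewrite /unitization_act/= -[0 in LHS](subrr x) amulDl amulNl subrr add0r scale1r.
Qed.

Lemma act_oneD (z : R[i]) u (x : A) :
  act ((0, 1) + z *: u) x = x + z *: act u x.
Proof. by rewrite actD actZ act_one. Qed.

Lemma actDr u (x y : A) : act u (x + y) = act u x + act u y.
Proof. by rewrite /unitization_act amulDr scalerDr addrACA. Qed.

(** The state is u |-> phi (u x), contractive because |phi (u x)| <= |u x| <= |u|_op. *)
Lemma act_state (x : A) (phi : {linear A -> R[i]^o}) :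
  rnorm x = 1 -> support_functionals x phi ->
  exists f : {linear Aop -> R[i]^o},
    support_functionals one f /\ forall u, f u = phi (act u x).
Proof.
move=> x1 /(support_functionalsP _ _ _ _ x1)[phin phix].
pose g (u : Aop) : R[i]^o := phi (act u x).
have glin : linear g by move=> z u v; rewrite /g actD actZ linearP.
pose gl := GRing.isLinear.Build R[i] Aop R[i]^o _ g glin.
pose f : {linear Aop -> R[i]^o} := HB.pack g gl.
exists f; split=> //; apply/support_functionalsP.
  exact: unit_op_sphere.
split; last by rewrite -phix -[X in phi X = _]/(act (0, 1) x) act_one.
move=> u; apply: le_trans (phin _) _.
by have := op_norm_act u x; rewrite x1 mulr1.
Qed.

Definition spatial_upper_bound u mu := forall x (phi : {linear A -> R[i]^o}),
  rnorm x = 1 -> support_functionals x phi -> complex.Re (phi (act u x)) <= mu.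

(** For a unit vector y and phi supporting y, |y - r u y| >= Re phi (y - r u y) = 1 - r Re phi (u y)
    >= 1 - r mu; the general case follows by scaling. *)
Lemma spatial_lower_estimate u mu (r : R) (x : A) :
  spatial_upper_bound u mu -> 0 <= r ->
  (1 - r * mu) * rnorm x <= rnorm (x - r%:C *: act u x).
Proof.
move=> umu r0; have [/rnorm_eq0 ->|x0] := eqVneq (rnorm x) 0.
  by rewrite rnorm0 mulr0 rnorm_ge0.
have xgt0 : 0 < rnorm x by rewrite lt_neqAle eq_sym x0 rnorm_ge0.
pose y := (rnorm x)^-1%:C *: x.
have y1 : rnorm y = 1.
  by rewrite /y rnormZ_real gtr0_norm ?invr_gt0// mulVf.
have xE : x = (rnorm x)%:C *: y.
  by rewrite scalerA -rmorphM/= mulfV// scale1r.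
have -> : x - r%:C *: act u x = (rnorm x)%:C *: (y - r%:C *: act u y).
  by rewrite scalerBr -xE {2}xE act_scale !scalerA mulrC.
rewrite rnormZ_real gtr0_norm// mulrC ler_pM2l//.
have [phi sphi] := support_functionals_neq0 _ _ _ y1.
have /(support_functionalsP _ _ _ _ y1)[phin phiy] := sphi.
apply: le_trans (phin _); apply: le_trans (Re_le_rnorm _ _).
have -> : phi (y - r%:C *: act u y) = 1 - r%:C * phi (act u y).
  by rewrite linearB phiy linearZ.
by rewrite ReD ReN ReZ lerD2l lerN2 ler_wpM2l// umu.
Qed.

(* Apply the lower estimate for 1 - r u to the vectors (1 + r u) x. *)
Lemma op_norm_oneD_le u mu (r : R) :
  spatial_upper_bound u mu -> 0 <= r -> r * mu < 1 ->
  op_norm ((0, 1) + r%:C *: u)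
    <= (1 + r ^+ 2 * op_norm (unitization_mul u u)) / (1 - r * mu).
Proof.
move=> umu r0 rmu; apply: op_norm_least => x x1.
rewrite ler_pdivlMr ?subr_gt0// mulrC.
apply: le_trans (spatial_lower_estimate _ _ _ _ umu r0) _.
have -> : act ((0, 1) + r%:C *: u) x - r%:C *: act u (act ((0, 1) + r%:C *: u) x)
    = x - (r ^+ 2)%:C *: act (unitization_mul u u) x.
  rewrite actM !act_oneD actDr act_scale (scalerDr _ (act u x)) scalerA expr2 rmorphM/=.
  by rewrite opprD addrA addrK.
apply: le_trans (rnormD _ _) _; rewrite rnormN rnormZ_real.
apply: lerD => //; rewrite ger0_norm ?sqr_ge0// ler_wpM2l ?sqr_ge0//.
exact: op_norm_ub.
Qed.

Lemma state_le u mu (f : {linear Aop -> R[i]^o}) :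
  spatial_upper_bound u mu -> support_functionals one f ->
  complex.Re (f u) <= mu.
Proof.
move=> umu /(support_functionalsP _ _ _ _ (unit_op_sphere nuA fA))[fn f1].
set F := complex.Re (f u); pose K := op_norm (unitization_mul u u).
(* Combine 1 + r F <= |1 + r u|_op with the upper estimate, expand (1 + r F) (1 - r mu) <= 1 + r^2 K
   and divide by r. *)
have main r : 0 < r -> r * mu < 1 -> F - mu <= r * (K + mu * F).
  move=> r0 rmu; have := op_norm_oneD_le _ _ _ umu (ltW r0) rmu.
  rewrite -/K ler_pdivlMr ?subr_gt0// => H.
  have : 1 + r * F <= op_norm ((0, 1) + r%:C *: u).
    apply: le_trans (fn ((0, 1) + r%:C *: u)).
    apply: le_trans (Re_le_rnorm _ _).
    have -> : f ((0, 1) + r%:C *: u) = f one + r%:C * f u.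
      by rewrite -[r%:C * f u]/(r%:C *: f u) -linearZ -linearD.
    by rewrite f1 ReD ReZ.
  rewrite -(ler_pM2r (x := 1 - r * mu)) ?subr_gt0// => /le_trans /(_ H) H'.
  rewrite -(ler_pM2l r0); move: H'; rewrite expr2; nra.
apply/ler_addgt0Pr => e e0; set D := K + mu * F in main.
(* Dividing e by this quantity gives an r with both r mu < 1 and r D <= e. *)
have d0 : 0 < 1 + e * `|mu| + `|D|.
  by rewrite ltr_wpDr// ltr_wpDr// mulr_ge0// ltW.
have r0 : 0 < e / (1 + e * `|mu| + `|D|) by rewrite divr_gt0.
rewrite -lerBlDl; apply: le_trans (main _ r0 _) _.
  rewrite mulrAC ltr_pdivrMr// mul1r.
  have := ler_norm mu; have := normr_ge0 D; nra.
rewrite mulrAC ler_pdivrMr// ler_pM2l//.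
have := ler_norm D; have := normr_ge0 mu; nra.
Qed.

End Lumer.

(** * Convex sets in the complex plane *)

Section Plane.
Context (R : realType).
Local Notation C := (R[i]^o).
Local Notation nm z := (rnorm (z : C)).
Implicit Types (K : set C) (z : C).

Lemma closure_rnormP K z :
  closure K z <-> forall e : R, 0 < e -> exists2 k, K k & nm (z - k) < e.
Proof.
split=> [Kz e e0|H U].
  have [|k [Kk zk]] := Kz (ball z e%:C); first by apply: nbhsx_ballx; rewrite ltcR.
  exists k => //; rewrite -ltcR rnormE; exact: zk.
move=> /nbhs_ballP[e /= e0 zeU].
have eE : (complex.Re e)%:C = e by rewrite RRe_real// gtr0_real.
have [|k Kk zk] := H (complex.Re e); first by rewrite -ltcR eE.
exists k; split => //; apply: zeU.
by rewrite -ball_normE /ball_ /= -eE -rnormE ltcR.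
Qed.

Lemma convex_setP (S : set C) : convex_set S <->
  forall (t : R) (z w : R[i]), 0 <= t -> t <= 1 -> S z -> S w ->
    S (t%:C * z + (1 - t)%:C * w).
Proof.
split=> [cS t z w t0 t1 Sz Sw|cS z w l].
  have t0C : 0 <= t%:C by rewrite lecR.
  have t1C : t%:C <= 1 by rewrite lecR.
  have := cS z w (Itv01 t0C t1C); rewrite !inE => /(_ Sz Sw).
  by rewrite rmorphB.
rewrite !inE => Sz Sw; pose t := complex.Re l%:num.
have tE : t%:C = l%:num by rewrite RRe_real// ger0_real.
have -> : conv l z w = t%:C * z + (1 - t)%:C * w by rewrite rmorphB/= tE.
apply: cS => //; first by rewrite -ler0c tE; exact: ge0.
rewrite -lecR tE; exact: le1.
Qed.

Lemma closed_convex_hull_sub K S :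
  K `<=` S -> convex_set S -> closed S -> closed_convex_hull K `<=` S.
Proof.
move=> KS cS clS; rewrite [X in _ `<=` X](closure_id S).1//.
by apply: closureS; exact: smallest_sub.
Qed.

Lemma rnorm_ball_convex (M : R) : convex_set ([set z | nm z <= M] : set C).
Proof.
apply/convex_setP => t z w t0 t1 /= zM wM; apply: le_trans (rnormD _ _) _.
rewrite !rnormCM !rnormC_real !ger0_norm ?subr_ge0//.
have -> : M = t * M + (1 - t) * M by ring.
by rewrite lerD// ler_wpM2l// subr_ge0.
Qed.

(** Expand |(z - p) - t (k - p)|^2. As |z - p|^2 exceeds the lower bound d by less than t^2, the
    cross term 2 t Re (conj(z - p) (k - p)) is at most t^2 + t^2 L; divide by 2 t. *)
Lemma near_projection_estimate (t L d : R) (z p k : R[i]) : 0 < t ->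
  nm (z - p) ^+ 2 < d + t ^+ 2 -> nm (k - p) ^+ 2 <= L ->
  d <= nm (z - (t%:C * k + (1 - t)%:C * p)) ^+ 2 ->
  complex.Re ((z - p)^* * (k - p)) <= t * (1 + L) / 2.
Proof.
move=> t0; rewrite !sqr_rnormC.
case: z p k => [a b] [c e] [f g] /=; rewrite !mul0r !subr0.
set x1 := a - c; set x2 := b - e; set y1 := f - c; set y2 := g - e => zp kp.
have -> : a - (t * f + (1 - t) * c) = x1 - t * y1 by rewrite /x1 /y1; ring.
have -> : b - (t * g + 0 + ((1 - t) * e + 0)) = x2 - t * y2.
  by rewrite /x2 /y2; ring.
move=> dk; rewrite -(ler_pM2l t0).
have tkp : t * (t * (y1 ^+ 2 + y2 ^+ 2)) <= t * (t * L) by rewrite !ler_pM2l.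
nra.
Qed.

(* A nearly closest point p to z in the convex hull C of K is used in place of
   the projection: for c in C, Re((z - p)^* (c - p)) is at most of order the
   defect, while for c = z it is at least the squared distance of z to C. *)
Lemma halfplanes_closed_convex_hull K (M : R) z : K !=set0 ->
  (forall k, K k -> nm k <= M) ->
  (forall (w : R[i]) mu, (forall k, K k -> complex.Re (w * k) <= mu) ->
     complex.Re (w * z) <= mu) ->
  closed_convex_hull K z.
Proof.
move=> [k0 Kk0] KM Kz; pose S : set C := smallest (@convex_set R[i] C) K.
have cS : convex_set S.
  apply/convex_setP => t x y t0 t1 Sx Sy X XK.
  by move/convex_setP: (XK.1); apply => //; [exact: Sx|exact: Sy].
have KS : K `<=` S by exact: sub_gen_smallest.
have SM : S `<=` [set x | nm x <= M].
  by apply: smallest_sub; [exact: rnorm_ball_convex|exact: KM].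
apply/closure_rnormP => e e0; apply: contrapT => noS.
have Se k : S k -> e <= nm (z - k).
  by move=> Sk; rewrite leNgt; apply/negP => zk; apply: noS; exists k.
pose D : set R := [set nm (z - k) ^+ 2 | k in S].
have Dlb : lbound D (e ^+ 2).
  move=> _ [k Sk <-].
  by apply: lerXn2r; rewrite ?nnegrE ?rnorm_ge0 ?(ltW e0) ?Se.
have Dinf : has_inf D.
  by split; [exists (nm (z - k0) ^+ 2), k0 => //; exact: KS|exists (e ^+ 2)].
pose d := inf D.
have d0 : 0 < d.
  apply: lt_le_trans (lb_le_inf Dinf.1 Dlb); exact: exprn_gt0.
have dle k : S k -> d <= nm (z - k) ^+ 2.
  by move=> Sk; apply: ge_inf; [exact: Dinf.2|exists k].
(* [L] bounds |k - p|^2 for points of the hull, which lies in the disc of radius M; [t] is at most 1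
   and makes t (1 + L) / 2 smaller than d. *)
pose L : R := 4 * M ^+ 2.
have L0 : 0 <= L by rewrite mulr_ge0 ?sqr_ge0.
pose t : R := d / (1 + L + d).
have den0 : 0 < 1 + L + d by lra.
have t0 : 0 < t by by rewrite divr_gt0.
have t1 : t <= 1 by rewrite ler_pdivrMr//; lra.
have tL : t * (1 + L) / 2 < d.
  rewrite /t mulrAC -mulrA mulrAC ltr_pdivrMr//; nra.
have [_ [p Sp <-] pd] := inf_adherent (exprn_gt0 2 t0) Dinf.
have kp k : S k -> complex.Re ((z - p)^* * (k - p)) <= t * (1 + L) / 2.
  move=> Sk; have := dle _ ((convex_setP S).1 cS t k p (ltW t0) t1 Sk Sp).
  have kpL : nm (k - p) ^+ 2 <= L.
    have : nm (k - p) <= 2 * M.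
      apply: le_trans (rnormD _ _) _; rewrite rnormCN.
      by have := SM _ Sk; have := SM _ Sp => /=; lra.
    have := rnorm_ge0 (k - p : C); rewrite /L; nra.
  exact: (near_projection_estimate _ _ _ _ _ _ t0 pd).
(* The half-plane given by w = conj(z - p) contains K, hence z. This yields |z - p|^2 <= t (1 + L) /
   2 < d, against d <= |z - p|^2. *)
have : complex.Re ((z - p)^* * z) <=
    complex.Re ((z - p)^* * p) + t * (1 + L) / 2.
  apply: Kz => k /KS/kp; rewrite mulrBr ReD ReN; lra.
have := dle _ Sp; rewrite sqr_rnormC; move: tL.
case: (z) (p) => [a b] [c c'] /=; nra.
Qed.

End Plane.

(** * The Bohnenblust-Karlin inequality *)

Section CauchyEstimate.

(** X^n - 1 splits over F and is separable in characteristic 0, so there are n distinct n-th roots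
    of unity, and one of them is primitive. *)
Lemma exists_prim_root (F : numClosedFieldType) n : (0 < n)%N ->
  exists z : F, n.-primitive_root z.
Proof.
move=> n0; have [s] := closed_field_poly_normal ('X^n - 1 : {poly F}).
rewrite (monicP (monicXnsubC 1 n0)) scale1r => sE.
have s1 : all n.-unity_root s by apply/allP => z; rewrite -root_prod_XsubC -sE.
have us : uniq s.
  by rewrite -separable_prod_XsubC -sE separable_Xn_sub_1// pnatr_eq0 -lt0n.
have ns : (n <= size s)%N.
  by rewrite -ltnS -(size_prod_XsubC s id) -sE size_XnsubC.
by have /hasP[z _ nz] := has_prim_root n0 s1 us ns; exists z.
Qed.

(** Orthogonality of characters: a geometric sum, which z^m - 1 annihilates. *)
Lemma sum_prim_root (F : fieldType) n m (z : F) : n.-primitive_root z ->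
  \sum_(j < n) (z ^+ m) ^+ j = if (n %| m)%N then n%:R else 0.
Proof.
move=> nz; rewrite (prim_order_dvd nz); have [->|zm] := eqVneq (z ^+ m) 1.
  by under eq_bigr do rewrite expr1n; rewrite sumr_const card_ord.
have z1 : z ^+ m - 1 != 0 by rewrite subr_eq0.
apply: (mulfI z1).
by rewrite -subrX1 -exprM mulnC exprM (prim_expr_order nz) expr1n subrr mulr0.
Qed.

Context (R : realType) (V : normedModType R[i]).
Local Notation nm z := (rnorm (z : R[i]^o)).

Lemma rnormCX (z : R[i]) n : nm (z ^+ n) = nm z ^+ n.
Proof.
elim: n => [|n IH]; first by rewrite !expr0 rnormC_real normr1.
by rewrite !exprS rnormCM IH.
Qed.

Lemma rnorm_sum n (F : 'I_n -> V) :
  rnorm (\sum_(i < n) F i) <= \sum_(i < n) rnorm (F i).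
Proof.
elim/big_ind2 : _ => [|x a y b xa yb|//]; first by rewrite rnorm0.
by apply: le_trans (rnormD _ _) _; exact: lerD.
Qed.

(** A discrete Fourier transform replaces the contour integral: c_k is the average of w^(-k) times
    the polynomial over the (n+1)-st roots of unity w, with -k written as n + 1 - k. *)
Lemma cauchy_estimate n (c : nat -> V) (M : R) (k : nat) : (k <= n)%N ->
  (forall w : R[i], nm w = 1 -> rnorm (\sum_(i < n.+1) w ^+ i *: c i) <= M) ->
  rnorm (c k) <= M.
Proof.
move=> kn cM; have [z nz] := exists_prim_root R[i] n.+1 isT.
have z1 : nm z = 1.
  apply/eqP; rewrite -(@pexpr_eq1 _ _ n.+1) ?rnorm_ge0//.
  by rewrite -rnormCX (prim_expr_order nz) rnormC_real normr1.
have n0 : 0 < n.+1%:R :> R by rewrite ltr0Sn.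
have cE : n.+1%:R *: c k = \sum_(j < n.+1)
    z ^+ (j * (n.+1 - k)) *: \sum_(i < n.+1) (z ^+ j) ^+ i *: c i.
  under eq_bigr do rewrite scaler_sumr.
  rewrite exchange_big/= (bigD1 (Ordinal (kn : (k < n.+1)%N)))//=.
  rewrite [X in _ + X]big1 ?addr0; last first.
    (* For i <= n other than k, n + 1 does not divide n + 1 - k + i, so the sum over the roots of
       unity vanishes. *)
    move=> i ik.
    transitivity ((\sum_(j < n.+1) (z ^+ (n.+1 - k + i)) ^+ j) *: c i).
      rewrite scaler_suml; apply: eq_bigr => j _.
      by rewrite scalerA -!exprM -exprD mulnDl (mulnC j) (mulnC j).
    rewrite (sum_prim_root _ _ _ _ nz) ifF ?scale0r//; apply/negbTE/negP.
    have := ltn_ord i; have : i != k :> nat by [].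
    by move=> /eqP ik' ilt /dvdnP[[|[|q]]]; rewrite ?mulSn; lia.
  transitivity ((\sum_(j < n.+1) (z ^+ n.+1) ^+ j) *: c k).
    by rewrite (sum_prim_root _ _ _ _ nz) dvdnn.
  rewrite scaler_suml; apply: eq_bigr => j _.
  rewrite scalerA -!exprM -exprD; congr (z ^+ _ *: _).
  by rewrite -mulnDr subnK ?(mulnC j)// leqW.
have : n.+1%:R * rnorm (c k) <= n.+1%:R * M.
  have -> : n.+1%:R * rnorm (c k) = rnorm (n.+1%:R *: c k).
    by rewrite -(rmorph_nat (real_complex R)) rnormZ_real ger0_norm.
  rewrite cE; apply: le_trans (rnorm_sum _ _) _.
  have -> : n.+1%:R * M = \sum_(j < n.+1) M.
    by rewrite sumr_const card_ord mulr_natl.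
  apply: ler_sum => j _; rewrite rnormZ rnormCX z1 expr1n mul1r.
  by apply: cM; rewrite rnormCX z1 expr1n.
by rewrite ler_pM2l.
Qed.

End CauchyEstimate.

Section BohnenblustKarlin.
Context (R : realType) (A : normedAlgType R[i]).
Context (nuA : non_unital A) (fA : faithful A).
Local Notation Aop := (unitization_op nuA fA).
Local Notation one := (unit_op nuA fA).
Local Notation nm z := (rnorm (z : R[i]^o)).
Local Notation act := unitization_act.
Implicit Types (u : A * R[i]).

Lemma iter_act_le u n (y : A) :
  rnorm (iter n (act u) y) <= op_norm u ^+ n * rnorm y.
Proof.
elim: n => [|n IH]; first by rewrite expr0 mul1r.
rewrite iterS exprS -mulrA; apply: le_trans (op_norm_act _ _) _.
by rewrite ler_wpM2l// op_norm_ge0.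
Qed.

Lemma act0 u : act u 0 = 0.
Proof. by rewrite -(scale0r 0) act_scale !scale0r. Qed.

(** Binomial expansion of (1 + z u)^n y, by Pascal's recurrence c_k + u c_(k-1). Only the first two
    coefficients matter later; the vanishing beyond n lets the induction extend the range of
    summation. *)
Lemma iter_act_oneD u n (y : A) : exists c : nat -> A,
  [/\ c 0%N = y, c 1%N = n%:R *: act u y, forall k, (n < k)%N -> c k = 0
    & forall z, iter n (act ((0, 1) + z *: u)) y
        = \sum_(k < n.+1) z ^+ k *: c k].
Proof.
elim: n => [|n [c [c0 c1 cn cE]]].
  exists (fun k => if k == 0%N then y else 0); split => //.
  - by rewrite scale0r.
  - by case.
  - by move=> z; rewrite big_ord1 expr0 scale1r.
exists (fun k => c k + if k is k'.+1 then act u (c k') else 0); split.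
- by rewrite addr0.
- by rewrite c1 c0 -natr1 scalerDl scale1r.
- by case=> // k nk; rewrite !cn ?act0 ?addr0//; apply: ltnW.
move=> z; rewrite iterS act_oneD cE.
under [RHS]eq_bigr do rewrite scalerDr.
rewrite big_split/=; congr (_ + _).
  by rewrite [RHS]big_ord_recr/= cn// scaler0 addr0.
rewrite [RHS]big_ord_recl/= scaler0 add0r.
have -> : act u (\sum_(k < n.+1) z ^+ k *: c k)
    = \sum_(k < n.+1) z ^+ k *: act u (c k).
  elim/big_ind2 : _ => [|x a y' b <- <-|k _]; first exact: act0.
    by rewrite actDr.
  by rewrite act_scale.
rewrite scaler_sumr; apply: eq_bigr => k _.
by rewrite scalerA /bump/= add1n exprS.
Qed.

Lemma rnorm_act_state u (x : A) (phi : {linear A -> R[i]^o}) (nu : R) :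
  (forall f : {linear Aop -> R[i]^o}, support_functionals one f ->
     nm (f u) <= nu) ->
  rnorm x = 1 -> support_functionals x phi -> nm (phi (act u x)) <= nu.
Proof.
move=> unu x1 sphi; have [f [sf fE]] := act_state _ _ nuA fA x phi x1 sphi.
by rewrite -fE unu.
Qed.

(* The vector (1 + w r u)^n y is a polynomial in w with linear coefficient
   n r (u y); Cauchy's estimate on |w| = 1 bounds the latter, for r = 1/(n nu'),
   by (1 + r nu')^n <= e. *)
Lemma bohnenblust_karlin u (nu : R) : 0 <= nu ->
  (forall f : {linear Aop -> R[i]^o}, support_functionals one f ->
     nm (f u) <= nu) ->
  op_norm u <= expR 1 * nu.
Proof.
move=> nu0 unu.
(* The gap between [nu] and [nu'] absorbs the second-order term, and [nu'] can be inverted even if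
   [nu] is 0. *)
suff H nu' : nu < nu' -> op_norm u <= expR 1 * nu'.
  rewrite -ler_pdivrMl ?expR_gt0//; apply/ler_addgt0Pr => e e0.
  by rewrite ler_pdivrMl ?expR_gt0// H// ltrDl.
move=> nunu'; have nu'0 : 0 < nu' by exact: le_lt_trans nunu'.
pose K := op_norm u ^+ 2; have K0 : 0 <= K by exact: sqr_ge0.
(* With r = 1 / (n nu'), n >= X amounts to r (K + nu nu') <= nu' - nu, that is, to 1 + r^2 K <= (1 +
   r nu') (1 - r nu). *)
pose X := (K + nu * nu') / (nu' * (nu' - nu)).
have den0 : 0 < nu' * (nu' - nu) by rewrite mulr_gt0// subr_gt0.
have X0 : 0 <= X.
  by apply: divr_ge0; [rewrite addr_ge0// mulr_ge0// ltW|exact: ltW].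
pose n := (Num.bound X).+1.
have nX : X <= n%:R.
  by rewrite ltW// (lt_trans (archi_boundP X0))// ltr_nat.
have n1 : 1 <= n%:R :> R by rewrite ler1n.
have n0 : 0 < n%:R :> R by exact: lt_le_trans n1.
pose r := (n%:R * nu')^-1.
have r0 : 0 < r by rewrite invr_gt0 mulr_gt0.
have rE : r * (n%:R * nu') = 1 by rewrite mulVf// gt_eqF// mulr_gt0.
have rK : r * (K + nu * nu') <= nu' - nu.
  rewrite mulrC ler_pdivrMr ?mulr_gt0//.
  move: nX; rewrite /X ler_pdivrMr//; nra.
have rnu : r * nu < 1 by rewrite mulrC ltr_pdivrMr ?mulr_gt0//; nra.
have step (w : R[i]) : nm w = 1 ->
    op_norm ((0, 1) + (w * r%:C) *: u) <= 1 + r * nu'.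
  move=> w1; have wb : spatial_upper_bound _ _ (w *: u) nu.
    move=> x phi x1 sphi; apply: le_trans (Re_le_rnorm _ _) _.
    rewrite actZ linearZ/= rnormCM w1 mul1r.
    exact: rnorm_act_state x1 sphi.
  rewrite mulrC -scalerA.
  apply: le_trans (op_norm_oneD_le _ _ _ _ _ wb (ltW r0) rnu) _.
  rewrite ler_pdivrMr ?subr_gt0//.
  have : op_norm (unitization_mul (w *: u) (w *: u)) <= K.
    by apply: le_trans (op_normM _ _) _; rewrite op_normZ w1 mul1r.
  set k := op_norm _ => kK; have r2 : r ^+ 2 * k <= r * (r * K).
    by rewrite expr2 -mulrA !ler_pM2l.
  move: rK; rewrite -(ler_pM2l r0); nra.
apply: op_norm_least => y y1.
have [c [c0 c1 _ cE]] := iter_act_oneD u n y.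
have : rnorm (r%:C ^+ 1 *: c 1%N) <= expR 1.
  apply: (@cauchy_estimate _ _ n (fun k => r%:C ^+ k *: c k)) => // w w1.
  under eq_bigr do rewrite scalerA -exprMn.
  rewrite -cE; apply: le_trans (iter_act_le _ _ _) _.
  apply: (@le_trans _ _ ((1 + r * nu') ^+ n)).
    rewrite -[leRHS]mulr1 ler_pM ?exprn_ge0 ?op_norm_ge0 ?rnorm_ge0//.
    by rewrite lerXn2r ?nnegrE ?op_norm_ge0 ?addr_ge0 ?mulr_ge0 ?step// ltW.
  have -> : expR 1 = expR (r * nu') ^+ n.
    by rewrite -expRM_natr; congr expR; rewrite -[LHS]rE; ring.
  rewrite lerXn2r ?nnegrE ?expR_ge0 ?expR_ge1Dx//.
  by rewrite addr_ge0// mulr_ge0// ltW.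
rewrite expr1 c1 scalerA -(rmorph_nat (real_complex R)) -rmorphM/= rnormZ_real.
rewrite ger0_norm ?mulr_ge0 ?(ltW r0)//.
have -> : r * n%:R = nu'^-1.
  by rewrite /r invfM mulrAC mulVf ?mul1r// gt_eqF.
by rewrite ler_pdivrMl// mulrC.
Qed.

End BohnenblustKarlin.

(** * Numerical ranges in the unitization *)

Section UnitizationRange.
Context (R : realType) (A : normedAlgType R[i]).
Context (nuA : non_unital A) (fA : faithful A).
Local Notation Aop := (unitization_op nuA fA).
Local Notation one := (unit_op nuA fA).
Local Notation emb := (embed_op nuA fA).
Local Notation nm z := (rnorm (z : R[i]^o)).
Local Notation act := unitization_act.

Lemma mul_op_one (u : Aop) : u ** one = u.
Proof.
case: u => a l; rewrite mul_opE /unitization_mul/= mulr1 scaler0 addr0 scale1r.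
by rewrite -[0 in LHS](scale0r 0) amulZr scale0r add0r.
Qed.

(** This description without functionals makes convexity and closedness direct consequences of the
    triangle inequality. *)
Lemma num_range_at_oneP (u : Aop) (z : R[i]) : num_range_at u one z <->
  forall k l : R[i], nm (k + l * z) <= rnorm (k *: one + l *: u).
Proof.
split=> [[f sf <-] k l|H].
  have /(support_functionalsP _ _ _ _ (unit_op_sphere nuA fA))[fn f1] := sf.
  rewrite mul_op_one; apply: le_trans (fn _).
  by rewrite linearD !linearZ/= f1 [k *: 1]mulr1.
have [|f [fn f1 fu]] := hahn_banach_two R Aop one u 1 z.
  by move=> k l; rewrite mulr1.
exists f; last by rewrite mul_op_one.
exact/(support_functionalsP _ _ _ _ (unit_op_sphere nuA fA)).
Qed.

Lemma num_range_at_one_le (u : Aop) (z : R[i]) :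
  num_range_at u one z -> nm z <= rnorm u.
Proof.
move=> /num_range_at_oneP/(_ 0 1).
by rewrite mul1r scale0r scale1r !add0r.
Qed.

Lemma num_range_at_one_convex (u : Aop) : convex_set (num_range_at u one).
Proof.
apply/convex_setP => t z w t0 t1 /num_range_at_oneP uz /num_range_at_oneP uw.
apply/num_range_at_oneP => k l; set M := (X in _ <= X).
have -> : k + l * (t%:C * z + (1 - t)%:C * w)
    = t%:C * (k + l * z) + (1 - t)%:C * (k + l * w).
  by rewrite rmorphB/=; ring.
apply: le_trans (rnormD _ _) _.
rewrite !rnormCM !rnormC_real !ger0_norm ?subr_ge0//.
have -> : M = t * M + (1 - t) * M by ring.
by rewrite lerD// ler_wpM2l ?subr_ge0 ?uz ?uw.
Qed.

Lemma num_range_at_one_closed (u : Aop) : closed (num_range_at u one).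
Proof.
move=> z /closure_rnormP uz; apply/num_range_at_oneP => k l.
apply/ler_addgt0Pr => e e0.
have d0 : 0 < 1 + nm l by rewrite ltr_pwDl// rnorm_ge0.
have [w /num_range_at_oneP/(_ k l) uw zw] := uz _ (divr_gt0 e0 d0).
have -> : k + l * z = (k + l * w) + l * (z - w) by ring.
apply: le_trans (rnormD _ _) _; apply: lerD => //; rewrite rnormCM.
move: zw; rewrite ltr_pdivlMr// => zw.
have := rnorm_ge0 (z - w : R[i]^o); have := rnorm_ge0 (l : R[i]^o); nra.
Qed.

Lemma act_emb (a x : A) : act (a, 0) x = a ** x.
Proof. by rewrite /unitization_act/= scale0r addr0. Qed.

Lemma num_range_sub (a : A) : num_range a `<=` num_range_at (emb a) one.
Proof.
move=> _ [x x1 [phi sphi <-]].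
have [f [sf fE]] := act_state _ _ nuA fA x phi x1 sphi.
by exists f => //; rewrite mul_op_one fE act_emb.
Qed.

(** Otherwise A = {0}, where 0 is an identity element. *)
Lemma unit_vector : exists x : A, rnorm x = 1.
Proof.
apply: contrapT => noS; apply: nuA; exists 0 => y.
have Z (x : A) : x = 0.
  apply: rnorm_eq0; apply: contrapT => /eqP x0; apply: noS.
  have xgt0 : 0 < rnorm x by rewrite lt_neqAle eq_sym x0 rnorm_ge0.
  exists ((rnorm x)^-1%:C *: x).
  by rewrite rnormZ_real gtr0_norm ?invr_gt0// mulVf.
by split; rewrite [LHS]Z [RHS]Z.
Qed.

Lemma num_range_neq0 (a : A) : num_range a !=set0.
Proof.
have [x x1] := unit_vector; have [phi sphi] := support_functionals_neq0 _ _ _ x1.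
by exists (phi (a ** x)), x => //; exists phi.
Qed.

(* Lumer: num_range a and num_range_at (emb a) one have the same support
   function. *)
Lemma num_range_at_Re_le (a : A) (w z : R[i]) (mu : R) :
  num_range_at (emb a) one z ->
  (forall k, num_range a k -> complex.Re (w * k) <= mu) ->
  complex.Re (w * z) <= mu.
Proof.
move=> [f sf <-] wmu; rewrite mul_op_one.
have -> : w * f (emb a) = f (w *: (a, 0)) by rewrite linearZ.
apply: state_le sf => x phi x1 sphi.
rewrite actZ linearZ/= act_emb; apply: wmu.
by exists x => //; exists phi.
Qed.

Lemma closed_convex_hull_num_range (a : A) :
  closed_convex_hull (num_range a) = num_range_at (emb a) one.
Proof.
apply/seteqP; split=> [|z za].
  apply: closed_convex_hull_sub; first exact: num_range_sub.
    exact: num_range_at_one_convex.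
  exact: num_range_at_one_closed.
apply: (@halfplanes_closed_convex_hull _ _ (rnorm (emb a))).
- exact: num_range_neq0.
- by move=> k /num_range_sub/num_range_at_one_le.
- by move=> w mu; exact: num_range_at_Re_le.
Qed.

Lemma num_range_at_neq0 (u : Aop) : num_range_at u one !=set0.
Proof.
have [f sf] := support_functionals_neq0 _ _ _ (unit_op_sphere nuA fA).
by exists (f (u ** one)), f.
Qed.

Lemma num_radius_at_ub (u : Aop) (z : R[i]) :
  num_range_at u one z -> nm z <= num_radius_at u one.
Proof.
move=> uz; apply: ub_le_sup; last by exists z.
by exists (rnorm u) => _ [w uw <-]; exact: num_range_at_one_le.
Qed.

Lemma num_radius_at_le (u : Aop) : num_radius_at u one <= rnorm u.
Proof.
apply: ge_sup; last by move=> _ [w uw <-]; exact: num_range_at_one_le.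
by have [z uz] := num_range_at_neq0 u; exists (nm z), z.
Qed.

Lemma num_radius_atE (a : A) : num_radius a = num_radius_at (emb a) one.
Proof.
apply/eqP; rewrite eq_le; apply/andP; split; apply: ge_sup.
- by have [z az] := num_range_neq0 a; exists (nm z), z.
- by move=> _ [z /num_range_sub az <-]; exact: num_radius_at_ub.
- by have [z az] := num_range_at_neq0 (emb a); exists (nm z), z.
(* After rotation |z| is the real part of w z, which the support function of the spatial range
   controls. *)
move=> _ [z az <-]; have [w w1 wz] := rotate_rnorm R z.
rewrite -[nm z]/(complex.Re (nm z)%:C) -wz.
apply: num_range_at_Re_le az _ => k ak.
apply: le_trans (Re_le_rnorm _ _) _; rewrite rnormCM w1 mul1r.
apply: ub_le_sup; last by exists k.
by exists (rnorm (emb a)) => _ [y /num_range_sub/num_range_at_one_le ? <-].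
Qed.

Lemma num_radius_at_ge (u : Aop) :
  (expR 1)^-1 * rnorm u <= num_radius_at u one.
Proof.
rewrite ler_pdivrMl ?expR_gt0//; apply: (bohnenblust_karlin _ _ nuA fA).
  by have [z /num_radius_at_ub] := num_range_at_neq0 u; apply: le_trans;
    exact: rnorm_ge0.
by move=> f sf; apply: num_radius_at_ub; exists f => //; rewrite mul_op_one.
Qed.

(* If |1 + b|_op < 1, then (1 + b)^n = 1 + c_n tends to 0, so that -c_n is
   Cauchy in A and its limit is an identity element. *)
Lemma op_norm_one_add_ge (b : A) : regular_norm A -> complete_normed A ->
  1 <= op_norm (b, 1).
Proof.
move=> regA complA; rewrite leNgt; apply/negP; set q := op_norm (b, 1) => q1.
have q0 : 0 <= q by exact: op_norm_ge0.
pose pw n := iter n (unitization_mul (b, 1)) (0, 1).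
pose c n := (pw n).1.
have pwE n : pw n = (c n, 1).
  rewrite [LHS]surjective_pairing; congr pair.
  by elim: n => //= n IH; rewrite [X in 1 * X]IH mulr1.
have pwq n : op_norm (pw n) <= q ^+ n.
  elim: n => [|n IH].
    rewrite expr0; apply: op_norm_least => x; by rewrite act_one.
  rewrite exprS; apply: le_trans (op_normM _ _) _.
  by rewrite ler_wpM2l.
(* Regularity enters here: the identities cancel in (x + 1) - (1 + b)^n, so distances in A are read
   off from the operator norm. *)
have distE (x : A) n : rnorm (x - c n) = op_norm ((x, 1) - pw n).
  by rewrite -regA pwE; congr op_norm; congr pair; rewrite /= subrr.
have qcvg : (fun n => q ^+ n) @ \oo --> (0 : R).
  by apply: cvg_expr; rewrite ger0_norm.
have qsmall (e : R) : 0 < e -> \forall n \near \oo, q ^+ n < e.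
  move=> e0; move/cvgrPdist_lt: qcvg => /(_ _ e0); apply: filterS => n.
  by rewrite sub0r normrN ger0_norm// exprn_ge0.
have cC : cauchy (c @ \oo).
  apply: cauchy_exP => e e0.
  have eE : (complex.Re e)%:C = e by rewrite RRe_real// gtr0_real.
  have e20 : 0 < complex.Re e / 2 by rewrite divr_gt0// -ltcR eE.
  have [N _ Nq] := qsmall _ e20.
  exists (c N); exists N => // n Nn.
  rewrite /= -ball_normE /ball_ /= -rnormE -eE ltcR distE -pwE.
  rewrite -scaleN1r; apply: le_lt_trans (op_normD _ _) _.
  rewrite op_normZ rnormCN rnormC_real normr1 mul1r.
  rewrite [ltRHS]splitr ltrD//.
    by apply: le_lt_trans (pwq N) (Nq _ _) => /=.
  by apply: le_lt_trans (pwq n) (Nq _ _).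
have /cvg_ex[x /= cx] : cvg (c @ \oo) by exact: complA cC.
have x0 : op_norm (x, 1) = 0.
  apply/eqP; rewrite eq_le op_norm_ge0 andbT; apply/ler_addgt0Pr => e e0.
  rewrite add0r; have e20 : 0 < e / 2 by rewrite divr_gt0.
  have e20C : 0 < (e / 2)%:C by rewrite ltcR.
  move/cvgrPdist_lt: cx => /(_ _ e20C) cx.
  have [n [xn qn]] := filter_ex (filterI cx (qsmall _ e20)).
  have -> : (x, 1) = ((x, 1) - pw n) + pw n by rewrite subrK.
  apply: le_trans (op_normD _ _) _; rewrite -distE [leRHS]splitr lerD//.
    by rewrite ltW// -ltcR rnormE.
  exact: le_trans (pwq n) (ltW qn).
(* The operator norm is definite on the unitization, so x + 1 = 0, although its scalar part is 1. *)
have /(congr1 snd)/= /eqP := op_norm_eq0 nuA fA x0.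
by rewrite oner_eq0.
Qed.

Lemma num_range_at_0 (a : A) : regular_norm A -> complete_normed A ->
  num_range_at (emb a) one 0.
Proof.
move=> regA complA; apply/num_range_at_oneP => k l; rewrite mulr0 addr0.
have [->|k0] := eqVneq k 0; first by rewrite rnorm0 rnorm_ge0.
(* Factoring out k leaves 1 + b with b = k^-1 l a in A, whose norm is at least 1. *)
have -> : k *: one + l *: emb a = k *: ((k^-1 * l) *: a, 1).
  congr pair; rewrite /= ?scaler0 ?add0r ?scalerA ?mulrA ?mulfV ?mul1r//.
  by rewrite addr0.
rewrite rnormZ -[leLHS]mulr1 ler_wpM2l ?rnorm_ge0//.
exact: op_norm_one_add_ge.
Qed.

End UnitizationRange.

Theorem theorem2p4 (R : realType) (A : normedAlgType R[i])
    (nuA : non_unital A) (fA : faithful A) :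
  let one := unit_op nuA fA in
  let emb := embed_op nuA fA in
  (forall a : A,
     closed_convex_hull (num_range a) = num_range_at (emb a) one) /\
  (forall a : A, num_radius a = num_radius_at (emb a) one) /\
  (forall (a : A) (l : R[i]),
     (expR 1)^-1 * rnorm (emb a + l *: one)
       <= num_radius_at (emb a + l *: one) one
       <= rnorm (emb a + l *: one)) /\
  (forall a : A,
     (expR 1)^-1 * rnorm (emb a) <= num_radius a <= rnorm (emb a)) /\
  (regular_norm A ->
     forall a : A, (expR 1)^-1 * rnorm a <= num_radius a <= rnorm a) /\
  (regular_norm A -> complete_normed A ->
     forall a : A, closed_convex_hull (num_range a) 0).
Proof.
move=> one emb.
have bounds u :
    (expR 1)^-1 * rnorm u <= num_radius_at u one <= rnorm u.
  by rewrite num_radius_at_ge num_radius_at_le.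
have radius_bounds a :
    (expR 1)^-1 * rnorm (emb a) <= num_radius a <= rnorm (emb a).
  by rewrite (num_radius_atE _ _ nuA fA) bounds.
split; first exact: closed_convex_hull_num_range.
split; first exact: num_radius_atE.
split; first by [].
split; first by [].
split=> [regA a|regA complA a]; first by rewrite -regA; exact: radius_bounds.
by rewrite (closed_convex_hull_num_range _ _ nuA fA); exact: num_range_at_0.
Qed.
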